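(* Let $1<k<n$ be integers, $\alpha,\beta$ positive real numbers and $\lambda:=\beta/\alpha$. Let $\mathcal{F}=\mathcal{A}\cup\mathcal{B}$ with $\mathcal{A}\subseteq\binom{[n]}k$ and $\mathcal{B}\subseteq\binom{[n]}{k-1}$ be a full squashed flat antichain, and let $m=\sum_{i=1}^k\binom{a_i}{i}$ be the $k$-cascade representation of $m:=|\mathcal{A}|$. Then $\mathcal{F}$ has minimum weight $w(\mathcal{F})=\alpha|\mathcal{A}|+\beta|\mathcal{B}|$ among all full squashed flat antichains contained in $\binom{[n]}k\cup\binom{[n]}{k-1}$ if and only if, for every $i\in[k]$, \[ a_i=\begin{cases} n-k-1+i & \text{if } i>1+(n-k)/\lambda,\\ \lceil (i-1)(\lambda+1)-1\rceil \text{ or } \lfloor (i-1)(\lambda+1)\rfloor & \text{if } 1+(n-k)/\lambda\ge i\ge 1+2/\lambda,\\ i & \text{if } 1+2/\lambda>i>1/\lambda,\\ 0 \text{ or } i & \text{if } 1/\lambda=i,\\ 0 & \text{if } 1/\lambda>i. \end{cases} \]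
   Context: $[n]=\{1,\dots,n\}$, $\binom{[n]}{i}$ is the family of $i$-subsets of $[n]$. Squashed (colexicographic) order: for distinct $F,G\subseteq[n]$, $F<_S G$ iff $\max\bigl((F\cup G)\setminus(F\cap G)\bigr)\in G$. For $\mathcal{G}\subseteq\binom{[n]}{i}$, the shadow is $\Delta\mathcal{G}=\{H\in\binom{[n]}{i-1}: H\subset G \text{ for some } G\in\mathcal{G}\}$. A full squashed flat antichain (FSFA) in $\binom{[n]}k\cup\binom{[n]}{k-1}$ is a family $\mathcal{A}\cup\mathcal{B}$ where, for some $0\le m\le\binom nk$, $\mathcal{A}$ is the set of the first $m$ elements of $\binom{[n]}{k}$ in squashed order and $\mathcal{B}=\binom{[n]}{k-1}\setminus\Delta\mathcal{A}$. The $k$-cascade representation of an integer $0\le m\le\binom nk$ is the unique representation $m=\sum_{i=1}^k\binom{a_i}{i}$ with integers $a_k>a_{k-1}>\dots>a_t\ge t>0=a_{t-1}=\dots=a_1$ for some $t\in\{1,\dots,k+1\}$ (the terms with $a_i=0$ are included and contribute $0$; for $m=0$ all $a_i=0$). *)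

(* Defs.v *)
From mathcomp Require Import all_boot all_order all_algebra.
From mathcomp Require Import reals.

Set Implicit Arguments.
Unset Strict Implicit.
Unset Printing Implicit Defensive.

Import Order.TTheory GRing.Theory Num.Theory.

(* The ground set {1, .., n} is represented by 'I_n; the shift by one is an
   order isomorphism, and only the order of the elements is ever used. *)

Definition layer (n i : nat) : {set {set 'I_n}} := [set F : {set 'I_n} | #|F| == i].

Definition symdiff (n : nat) (F G : {set 'I_n}) : {set 'I_n} :=
  (F :|: G) :\: (F :&: G).

(* Irreflexive: for F = G the symmetric difference has no maximum. *)
Definition squashed_lt (n : nat) (F G : {set 'I_n}) : bool :=
  [exists x in symdiff F G, [forall y in symdiff F G, y <= x] && (x \in G)].

(* An i-set is among the first m in squashed order iff fewer than m i-sets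
   strictly precede it. *)
Definition first_squashed (n i m : nat) : {set {set 'I_n}} :=
  [set F in layer n i | #|[set G in layer n i | squashed_lt G F]| < m].

Definition shadow (n i : nat) (GG : {set {set 'I_n}}) : {set {set 'I_n}} :=
  [set H in layer n i.-1 | [exists G in GG, H \subset G]].

Definition fsfa (n k : nat) (F : {set {set 'I_n}}) : Prop :=
  exists2 m : nat, m <= 'C(n, k) &
    F = first_squashed n k m
          :|: (layer n k.-1 :\: shadow k (first_squashed n k m)).

(* Only the values a 1, .., a k matter.  The value t = k.+1 is allowed and
   forces a 1 = .. = a k = 0. *)
Definition is_cascade (k m : nat) (a : nat -> nat) : Prop :=
  m = \sum_(1 <= i < k.+1) 'C(a i, i) /\
  exists t : nat,
    [/\ 1 <= t <= k.+1,
        forall i, t <= i < k -> a i < a i.+1,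
        t <= k -> t <= a t
      & forall i, 1 <= i < t -> a i = 0].

Local Open Scope ring_scope.

Definition weight (R : realType) (n k : nat) (alpha beta : R)
    (F : {set {set 'I_n}}) : R :=
  alpha * #|F :&: layer n k|%:R + beta * #|F :&: layer n k.-1|%:R.

Definition min_weight_fsfa (R : realType) (n k : nat) (alpha beta : R)
    (F : {set {set 'I_n}}) : Prop :=
  fsfa k F /\
  forall F' : {set {set 'I_n}}, fsfa k F' ->
    weight k alpha beta F <= weight k alpha beta F'.

(* Main.v *)
Require Import Defs.
From mathcomp Require Import all_boot all_order all_algebra.
From mathcomp Require Import reals.
From mathcomp Require Import zify ring lra.

Import Order.TTheory GRing.Theory Num.Theory.

(* An initial segment of the squashed order whose size has cascade digits
   [a k, .., a 1] consists of all k-subsets of the first [a k] points, together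
   with the sets obtained by adding the point number [a k] to the members of the
   initial segment with digits [a k.-1, .., a 1].  Its shadow decomposes in the
   same way, so the weight of a full squashed flat antichain is a constant plus
   alpha times the sum over the nonzero digits of
   'C(a i, i) - lambda * 'C(a i, i.-1).  The increment of this term from [i + j]
   to [i + j + 1] has the sign of j + 2 - lambda * (i - 1), so each term is
   unimodal in its digit.  The digitwise minimisers can be chosen to form a
   cascade; therefore the minimum weight is attained exactly when every digit is
   a minimiser, and these minimisers are the listed values.  The only family
   outside this scheme, m = 'C(n, k), loses to m = 'C(n, k) - 1, which has the
   same shadow. *)

(** * The squashed order and its initial segments *)

Lemma in_symdiff {n : nat} (F G : {set 'I_n}) (x : 'I_n) :
  (x \in symdiff F G) = ((x \in F) != (x \in G)).
Proof. by rewrite !inE; case: (x \in F); case: (x \in G). Qed.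

Lemma squashed_ltP {n : nat} {F G : {set 'I_n}} :
  reflect (exists x : 'I_n, [/\ x \in G, x \notin F &
             forall y : 'I_n, x < y -> (y \in F) = (y \in G)])
          (squashed_lt F G).
Proof.
apply: (iffP existsP) => [[x /and3P[xd /forallP max_x xG]]|[x [xG xF agree]]].
  exists x; split=> //; first by move: xd; rewrite in_symdiff xG; case: (x \in F).
  move=> y lt_xy; apply/eqP; apply: contraTT lt_xy => yd.
  by rewrite -leqNgt; apply: (implyP (max_x y)); rewrite in_symdiff.
exists x; rewrite in_symdiff xG (negPf xF) /= andbT.
apply/forallP=> y; apply/implyP; rewrite in_symdiff leqNgt.
by apply: contraNN => /agree ->.
Qed.

Lemma squashed_lt_irr {n : nat} (F : {set 'I_n}) : squashed_lt F F = false.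
Proof. by apply/negbTE/negP=> /squashed_ltP[x [xF]]; rewrite xF. Qed.

Lemma squashed_lt_total {n : nat} (F G : {set 'I_n}) :
  F != G -> squashed_lt F G || squashed_lt G F.
Proof.
move=> neqFG; have [x0 x0d] : exists x, x \in symdiff F G.
  apply/existsP; apply: contraNT neqFG => /existsPn same.
  by apply/eqP/setP=> x; apply/eqP; have := same x; rewrite in_symdiff negbK.
case: (@arg_maxnP _ x0 (mem (symdiff F G)) (fun x => val x) x0d) => x /=.
rewrite in_symdiff => xd max_x.
have agree (y : 'I_n) : x < y -> (y \in F) = (y \in G).
  move=> lt_xy; apply/eqP; apply: contraTT lt_xy => yd.
  by rewrite -leqNgt; apply: max_x; rewrite /= in_symdiff.
case xG: (x \in G) xd => xd.
  by apply/orP; left; apply/squashed_ltP; exists x; split=> //; case: (x \in F) xd.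
apply/orP; right; apply/squashed_ltP; exists x; split; rewrite ?xG //.
  by case: (x \in F) xd.
by move=> y /agree ->.
Qed.

Definition squashed_initial {n : nat} (k : nat) (D : {set {set 'I_n}}) : Prop :=
  D \subset layer n k /\
  forall F G : {set 'I_n}, F \in D -> #|G| = k -> squashed_lt G F -> G \in D.

(** For [F] in [D] the predecessors of [F] all lie in [D] without [F], so there are fewer than
    [#|D|] of them. For [F] outside [D], totality of the order forces every member of [D] to precede
    [F]. *)
Lemma first_squashed_initial {n : nat} (k : nat) (D : {set {set 'I_n}}) :
  squashed_initial k D -> first_squashed n k #|D| = D.
Proof.
case=> sub down; apply/setP=> F; rewrite inE.
have [FD|FnD] := boolP (F \in D).
  rewrite (subsetP sub) //=; apply: proper_card; apply/properP; split.
    by apply/subsetP=> G; rewrite !inE => /andP[/eqP cG ltGF]; apply: down ltGF.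
  by exists F; rewrite // !inE squashed_lt_irr andbF.
apply: contraNF FnD => /andP[FL]; rewrite ltnNge => /negP small.
apply/negPn/negP=> FnD; apply: small.
apply: subset_leq_card; apply/subsetP=> G GD; rewrite inE (subsetP sub) //=.
have neq : G != F by apply: contraNneq FnD => <-.
have /orP[//|ltFG] := squashed_lt_total _ _ neq.
by move: FnD; rewrite (down G F) // ; move: FL; rewrite inE => /eqP.
Qed.

(* Equivalent to the clause on [t] in [is_cascade], but local in [i], hence
   inherited when [k] is lowered. *)
Definition cascade_shape (k : nat) (a : nat -> nat) : Prop :=
  (forall i, 1 <= i <= k -> a i = 0 \/ i <= a i) /\
  (forall i, 1 <= i < k -> a i = 0 \/ a i < a i.+1).

Lemma is_cascade_shape {k m : nat} {a : nat -> nat} :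
  is_cascade k m a -> cascade_shape k a.
Proof.
case=> _ [t [/andP[t0 tk] inc at_t zero]]; split=> i /andP[i1 ik].
  have [lt_it|le_ti] := ltnP i t; first by left; apply: zero; rewrite i1.
  right; elim: i le_ti {i1} ik => [|i IH]; first by lia.
  rewrite leq_eqVlt => /orP[/eqP <- //|lt_ti ik].
  by have := inc i; have := IH; lia.
have [lt_it|le_ti] := ltnP i t; first by left; apply: zero; rewrite i1.
by right; apply: inc; rewrite le_ti.
Qed.

Lemma cascade_shape_pred {k : nat} {a : nat -> nat} :
  cascade_shape k.+1 a -> cascade_shape k a.
Proof. by case=> H1 H2; split=> i Hi; [apply: H1 | apply: H2]; lia. Qed.

(** * Building initial segments digit by digit *)

Definition cascade_sum (k : nat) (a : nat -> nat) : nat :=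
  \sum_(1 <= i < k.+1) 'C(a i, i).

(* The guard matters for i = 1, where 'C(0, 0) = 1. *)
Definition cascade_shadow (k : nat) (a : nat -> nat) : nat :=
  \sum_(1 <= i < k.+1) (a i != 0) * 'C(a i, i.-1).

Definition below (n x : nat) : {set 'I_n} := [set y : 'I_n | y < x].

Lemma card_below {n x : nat} : x <= n -> #|below n x| = x.
Proof.
move=> xn; have inj : injective (widen_ord xn).
  by move=> y z /(congr1 val) /= /val_inj.
rewrite -[RHS]card_ord -(card_imset _ inj).
apply: eq_card => y; rewrite inE; apply/idP/imsetP => [yx|[z _ ->] //=].
by exists (Ordinal yx) => //; apply: val_inj.
Qed.

Lemma shadow0 (n k : nat) : shadow k (set0 : {set {set 'I_n}}) = set0.
Proof.
apply/setP=> H; rewrite !inE; apply/negbTE/negP=> /andP[_ /existsP[G]].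
by rewrite inE.
Qed.

Definition draws {n : nat} (x : 'I_n) (j : nat) : {set {set 'I_n}} :=
  [set G : {set 'I_n} | G \subset below n x & #|G| == j].

Lemma notin_below {n : nat} {x : 'I_n} {G : {set 'I_n}} :
  G \subset below n x -> x \notin G.
Proof. by move=> /subsetP s; apply/negP=> /s; rewrite inE ltnn. Qed.

(** [x] doubles as the digit in position [k.+1]: as a number it counts the points of [below n x],
    and as a point it is the first one outside that set. *)
Definition cascade_step {n : nat} (k : nat) (x : 'I_n) (D : {set {set 'I_n}}) :=
  draws x k.+1 :|: [set x |: G | G in D].

(** Only members of the second part contain [x], and adding [x] is injective on sets avoiding it.
    With [E] either a family or its shadow, this counts both sides of the recursion. *)
Lemma card_step_union {n : nat} (x : 'I_n) (j : nat) (E : {set {set 'I_n}}) :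
  (forall G, G \in E -> G \subset below n x) ->
  #|draws x j :|: [set x |: G | G in E]| = 'C(x, j) + #|E|.
Proof.
move=> E_lt; rewrite cardsU cards_draws card_below ?(ltnW (ltn_ord x)) //.
rewrite card_in_imset; last first.
  move=> G H /E_lt/notin_below xG /E_lt/notin_below xH /(congr1 (fun S => S :\ x)).
  by rewrite !setU1K.
rewrite (_ : _ :&: _ = set0) ?cards0 ?subn0 //; apply/setP=> G; rewrite !inE.
apply/negbTE/negP=> /andP[/andP[/notin_below xG _]] /imsetP[H _ E_G].
by move: xG; rewrite E_G setU11.
Qed.

Lemma cascade_step_initial {n : nat} (k : nat) (x : 'I_n) (D : {set {set 'I_n}}) :
  squashed_initial k D -> (forall G, G \in D -> G \subset below n x) ->
  squashed_initial k.+1 (cascade_step k x D).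
Proof.
move=> [subD downD] D_lt; split.
  apply/subsetP=> G; rewrite !inE => /orP[/andP[] // | /imsetP[H HD ->]].
  rewrite cardsU1 notin_below ?D_lt //.
  by have := subsetP subD _ HD; rewrite inE => /eqP ->.
move=> F G FS cG /squashed_ltP[y [yF yG agree]].
move: FS; rewrite !inE => /orP[/andP[F_lt _]|/imsetP[F' F'D EF]].
  apply/orP; left; rewrite cG eqxx andbT; apply/subsetP=> z zG; rewrite inE.
  have := subsetP F_lt _ yF; rewrite inE => yx.
  have [lt_yz|le_zy] := ltnP y z; last exact: leq_ltn_trans yx.
  by move: zG; rewrite agree // => /(subsetP F_lt); rewrite inE.
have F_le z : z \in F -> z <= x.
  rewrite EF !inE => /orP[/eqP -> // | /(subsetP (D_lt _ F'D))].
  by rewrite inE => /ltnW.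
(* Without [x], the set [G] can precede [F] only through the deciding point [x] itself, so [G] lies
   below [x]. With [x] in both sets, deleting it preserves the comparison and leads back to [D]. *)
have [xG|xG] := boolP (x \in G); last first.
  have y_x : y = x.
    apply: val_inj => /=; apply/eqP; rewrite eqn_leq F_le //= leqNgt.
    by apply: contraNN xG => /agree ->; rewrite EF setU11.
  apply/orP; left; rewrite cG eqxx andbT; apply/subsetP=> z zG; rewrite inE.
  rewrite ltnNge leq_eqVlt; apply/negP=> /orP[/eqP/val_inj xz|lt_xz].
    by rewrite xz zG in xG.
  by move: zG; rewrite agree ?y_x // => /F_le; rewrite leqNgt lt_xz.
apply/orP; right; apply/imsetP; exists (G :\ x); last by rewrite setD1K.
have xF' := notin_below (D_lt _ F'D).
have nyx : y != x by apply: contraNneq yG => ->.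
apply: (downD F') => //; first by move: cG; rewrite (cardsD1 x) xG => -[].
apply/squashed_ltP; exists y; split.
- by move: yF; rewrite EF !inE (negPf nyx).
- by rewrite !inE (negPf yG) andbF.
- move=> z /agree; rewrite EF !inE; case: eqP => [-> _|_ //].
  by rewrite (negPf xF').
Qed.

(* For k = 0 the family D = {set0} would be its own shadow, because of the
   truncated predecessor; hence the hypothesis on k. *)
Lemma shadow_cascade_step {n : nat} (k : nat) (x : 'I_n) (D : {set {set 'I_n}}) :
  k < x -> squashed_initial k D -> (forall G, G \in D -> 0 < k) ->
  (forall G, G \in D -> G \subset below n x) ->
  shadow k.+1 (cascade_step k x D) = draws x k :|: [set x |: H | H in shadow k D].
Proof.
move=> kx [subD _] k_gt0 D_lt.
have cD G : G \in D -> #|G| = k by move=> /(subsetP subD); rewrite inE => /eqP.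
apply/setP=> H; rewrite !inE /=; apply/idP/idP.
  case/andP=> cH /existsP[G /andP[]]; rewrite !inE.
  case/orP=> [/andP[G_lt _] HG|/imsetP[G' G'D EG] HG].
    by rewrite (subset_trans HG) ?cH.
  (* If [x] survives in [H], deleting it leaves a shadow element of [D]; otherwise [H] is contained
     in [G'], hence below [x]. *)
  have [xH|xH] := boolP (x \in H); apply/orP; [right|left].
    apply/imsetP; exists (H :\ x); last by rewrite setD1K.
    rewrite !inE; apply/andP; split.
      by move: cH; rewrite (cardsD1 x) xH => /eqP <-.
    apply/existsP; exists G'; rewrite G'D; apply/subsetP=> z.
    rewrite !inE => /andP[zx /(subsetP HG)].
    by rewrite EG !inE (negPf zx).
  rewrite cH andbT; apply: subset_trans (D_lt _ G'D); apply/subsetP=> z zH.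
  have := subsetP HG _ zH; rewrite EG !inE => /orP[/eqP zx|//].
  by rewrite -zx zH in xH.
case/orP=> [/andP[H_lt cH]|/imsetP[H']].
  (* As [k < x], the [k]-set [H] misses some point [z] below [x]; adding it gives a member of
     [draws x k.+1]. *)
  rewrite cH; have /subsetPn[z zx zH] : ~~ (below n x \subset H).
    apply/negP=> /subset_leq_card; rewrite card_below ?(ltnW (ltn_ord x)) //.
    by rewrite (eqP cH) leqNgt kx.
  apply/existsP; exists (z |: H); rewrite subsetUr !inE cardsU1 zH (eqP cH).
  by rewrite subUset sub1set zx H_lt eqxx.
rewrite !inE => /andP[cH' /existsP[G /andP[GD H'G]]] ->.
have cG := cD _ GD.
have xH' : x \notin H' by apply: contra (notin_below (D_lt _ GD)); apply: (subsetP H'G).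
rewrite cardsU1 xH' (eqP cH') /=; apply/andP; split; last first.
  apply/existsP; exists (x |: G); rewrite setUS // andbT !inE; apply/orP.
  by right; apply/imsetP; exists G.
by rewrite add1n prednK ?k_gt0 //; apply: k_gt0 GD.
Qed.

(** Induction on [k], one [cascade_step] per nonzero digit. The last clause serves the induction: it
    places the smaller family below the next digit, and it forces the family to be empty when its
    top digit is [0]. *)
Lemma cascade_initial {n k : nat} {a : nat -> nat} :
  cascade_shape k a -> (0 < k -> a k < n) ->
  exists D : {set {set 'I_n}},
    [/\ squashed_initial k D, #|D| = cascade_sum k a,
        #|shadow k D| = cascade_shadow k a
      & forall G, G \in D ->
          [/\ 0 < k, a k != 0 & forall x : 'I_n, x \in G -> x <= a k]].
Proof.
have ini0 j : squashed_initial j (set0 : {set {set 'I_n}}).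
  by split=> [|F G]; rewrite ?sub0set ?inE.
elim: k => [|k IH] sh lt_n.
  exists set0; rewrite shadow0 !cards0 /cascade_sum /cascade_shadow !big_geq //.
  by split=> // G; rewrite inE.
have lt_ak : 0 < k -> a k != 0 -> a k < a k.+1.
  by move=> k0 ak0; case: (sh.2 k _) => [|Ea|//]; [lia | rewrite Ea in ak0].
have [|D [iniD cD sD bD]] := IH (cascade_shape_pred sh).
  move=> k0; have [->|/(lt_ak k0) lt_a] := eqVneq (a k) 0; last first.
    exact: ltn_trans lt_a (lt_n isT).
  exact: leq_ltn_trans (lt_n isT).
rewrite /cascade_sum /cascade_shadow !(big_nat_recr k.+1) //=.
rewrite -/(cascade_sum k a) -/(cascade_shadow k a) -cD -sD.
(* A zero digit forces zeros in all lower positions, so the family built so far is empty and stays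
   so. *)
have [a0|an0] := eqVneq (a k.+1) 0.
  have D0 : D = set0.
    apply/setP=> G; rewrite inE; apply/negbTE/negP=> /bD[k0 ak0 _].
    by have := lt_ak k0 ak0; rewrite a0.
  exists set0; rewrite D0 !shadow0 !cards0 a0; split=> // G.
  by rewrite inE.
have k_lt : k < a k.+1.
  by case: (sh.1 k.+1 _) => // [|E]; [lia | rewrite E in an0].
pose x := Ordinal (lt_n isT : a k.+1 < n).
have D_lt G : G \in D -> G \subset below n x.
  move=> /bD[k0 ak0 le_a]; apply/subsetP=> y /le_a le_y; rewrite inE /=.
  exact: leq_ltn_trans le_y (lt_ak k0 ak0).
have k_gt0 G : G \in D -> 0 < k by case/bD.
exists (cascade_step k x D); split.
- exact: cascade_step_initial.
- by rewrite card_step_union 1?addnC.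
- rewrite shadow_cascade_step // card_step_union 1?addnC ?mul1n // => H.
  rewrite inE => /andP[_ /existsP[G /andP[/D_lt GD HG]]].
  exact: subset_trans HG GD.
- move=> G; rewrite !inE => GS; split=> // y yG.
  case/orP: GS => [/andP[/subsetP/(_ _ yG)]|/imsetP[G' /D_lt/subsetP s EG]].
    by rewrite inE => /ltnW.
  by move: yG; rewrite EG !inE => /orP[/eqP -> //|/s]; rewrite inE => /ltnW.
Qed.

(** * Existence of cascade representations *)

Lemma cascade_exists (n k m : nat) : m < 'C(n, k) -> 0 < k ->
  exists a : nat -> nat,
    [/\ cascade_shape k a, a k < n & cascade_sum k a = m].
Proof.
case: k => // k; elim: n k m => [|n IH] k m; first by rewrite bin0n.
rewrite binS => lt_m _.
have [m0|m_gt0] := posnP m.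
  exists (fun=> 0); split=> //; first by split=> i _; left.
  by rewrite m0 /cascade_sum big_nat big1 // => -[|i].
(* Greedy choice: if [m] reaches ['C(n, k.+1)], the top digit is [n], and by Pascal's rule the
   remainder is below ['C(n, k)], so its digits stay below [n]. *)
have [/IH/(_ isT)[a [sh lt_a sa]]|le_m] := ltnP m 'C(n, k.+1).
  by exists a; split=> //; apply: ltnW.
have lt_kn : k < n.
  rewrite ltnNge; apply/negP=> le_nk; move: lt_m; rewrite (@bin_small n k.+1) //.
  by move: le_nk; rewrite leq_eqVlt => /orP[/eqP ->|/bin_small ->]; rewrite ?binn; lia.
(* In position 1 the remainder is below ['C(n, 0) = 1], so [m = n] and the single digit [n]
   suffices. *)
case: k => [|k] in le_m lt_kn lt_m *.
  exists (fun=> n); split=> //; first by split=> i; lia.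
  rewrite /cascade_sum big_nat1; move: lt_m le_m; rewrite bin0 bin1; lia.
have [//|a [sh lt_a sa]] := IH k (m - 'C(n, k.+2)) _ isT.
  by rewrite ltn_subLR.
pose a' i := if i == k.+2 then n else a i.
have a'E i : i < k.+2 -> a' i = a i by rewrite /a'; case: eqP => //; lia.
have a'n : a' k.+2 = n by rewrite /a' eqxx.
exists a'; split; last first.
- rewrite /cascade_sum big_nat_recr //= a'n -[RHS](subnK le_m) -sa.
  congr addn; apply: eq_big_nat => i /andP[_ lt_i]; by rewrite a'E.
- by rewrite a'n.
split=> i /andP[i1 ik].
  have [->|neq] := eqVneq i k.+2; first by right; rewrite a'n.
  by rewrite a'E; [apply: sh.1; lia | lia].
have [->|neq] := eqVneq i k.+1; first by right; rewrite a'n a'E.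
by rewrite !a'E; [apply: sh.2; lia | lia | lia].
Qed.

Local Open Scope ring_scope.

(** * The contribution of a single digit and its minimisers *)

Definition cascade_term {R : realFieldType} (lam : R) (i a : nat) : R :=
  if a == 0%N then 0 else 'C(a, i)%:R - lam * 'C(a, i.-1)%:R.

Lemma cascade_termS {R : realFieldType} (lam : R) (p a : nat) :
  cascade_term lam p.+1 a.+1 = 'C(a.+1, p.+1)%:R - lam * 'C(a.+1, p)%:R.
Proof. by []. Qed.

Lemma cascade_term_first {R : realFieldType} (lam : R) (p : nat) :
  cascade_term lam p.+1 p.+1 = 1 - lam * p.+1%:R.
Proof. by rewrite cascade_termS binn binSn. Qed.

(** With [a = (p + j).+1], Pascal's rule gives the increment ['C(a, p) - lam * 'C(a, p.-1)] for
    positive [p], and [p * 'C(a, p) = j.+2 * 'C(a, p.-1)] lets a positive factor be pulled out. Only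
    the sign matters later, so [c] stays existential. *)
Lemma cascade_term_step {R : realFieldType} (lam : R) (p j : nat) :
  exists2 c : R, 0 < c &
    cascade_term lam p.+1 (p + j).+2 - cascade_term lam p.+1 (p + j).+1
      = c * (j.+2%:R - lam * p%:R).
Proof.
case: p => [|q].
  (* In position 1 the increment is exactly 1. *)
  exists (j.+2%:R)^-1; first by rewrite invr_gt0 ltr0n.
  rewrite !cascade_termS !bin1 !bin0 mulr0 subr0 mulVf ?pnatr_eq0 //.
  by rewrite add0n; lra.
set a := (q.+1 + j).+1.
exists ('C(a, q)%:R / q.+1%:R).
  by rewrite divr_gt0 ?ltr0n // bin_gt0 /a; lia.
have E : q.+1%:R * 'C(a, q.+1)%:R = j.+2%:R * 'C(a, q)%:R :> R.
  by rewrite -!natrM mul_bin_left (_ : (a - q)%N = j.+2) // /a; lia.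
rewrite !cascade_termS -/a; clearbody a; have q0 : q.+1%:R != 0 :> R by rewrite pnatr_eq0.
rewrite (binS a q.+1) (binS a q) !natrD.
have -> : 'C(a, q.+1)%:R = j.+2%:R * 'C(a, q)%:R / q.+1%:R :> R.
  by rewrite -E mulrC mulKf.
by field; rewrite ?nat1r ?natr1.
Qed.

Lemma cascade_term_nondecreasing {R : realFieldType} (lam : R) (p j d : nat) :
  lam * p%:R <= j.+2%:R ->
  cascade_term lam p.+1 (p + j).+1 <= cascade_term lam p.+1 (p + (j + d)).+1.
Proof.
move=> le_x; elim: d => [|d IH]; first by rewrite addn0.
apply: le_trans IH _; rewrite !addnS -subr_ge0.
have [c c0 ->] := cascade_term_step lam p (j + d).
rewrite mulr_ge0 ?(ltW c0) // subr_ge0 (le_trans le_x) // ler_nat; lia.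
Qed.

(** The last increment, into offset [l + d], starts at offset [l + d - 1], whence the bound
    [(l + d).+1]; the earlier increments have a smaller [j.+2] and are nonpositive as well. *)
Lemma cascade_term_nonincreasing {R : realFieldType} (lam : R) (p l d : nat) :
  (l + d).+1%:R <= lam * p%:R ->
  cascade_term lam p.+1 (p + (l + d)).+1 <= cascade_term lam p.+1 (p + l).+1.
Proof.
elim: d => [|d IH] le_x; first by rewrite addn0.
have {}IH := IH (le_trans _ le_x); apply: le_trans (IH _); last by rewrite ler_nat; lia.
rewrite !addnS -subr_le0; have [c c0 ->] := cascade_term_step lam p (l + d).
by rewrite pmulr_rle0 // subr_le0 -addnS.
Qed.

(** With [N = n - k - 1], this is the range left to digit [i] when the top digit is below [n]:
    strict growth up to position [k] bounds it by [n - 1 - (k - i) = i + N]. *)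
Definition cascade_digit (N i a : nat) : bool := (a == 0)%N || (i <= a <= i + N)%N.

(* A nonzero [a] minimises [cascade_term lam i] iff neither neighbour does
   strictly better and the value is nonpositive. *)
Definition optimal_digit {R : realFieldType} (lam : R) (N i a : nat) : bool :=
  if a == 0%N then lam * i%:R <= 1 else
  [&& 1 <= lam * i%:R, (a == i) || ((a - i).+1%:R <= lam * i.-1%:R)
    & (a == i + N)%N || (lam * i.-1%:R <= (a - i).+2%:R)].

(** By unimodality the term falls from digit [i] to [a] and rises after [a], so beating the
    neighbours suffices. The comparison with digit [0] goes through digit [i], whose term is
    [1 - lam * i%:R]. *)
Lemma optimal_digit_min {R : realFieldType} (lam : R) (N i a b : nat) :
  0 < lam -> (0 < i)%N ->
  cascade_digit N i a -> optimal_digit lam N i a -> cascade_digit N i b ->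
  cascade_term lam i a <= cascade_term lam i b.
Proof.
case: i => // p lam0 _; rewrite /cascade_digit.
have digitE c : (p < c <= p.+1 + N)%N -> exists2 j, (j <= N)%N & c = (p + j).+1.
  by move=> c_in; exists (c - p.+1)%N; lia.
have lower : lam * p.+1%:R <= 1 -> lam * p%:R <= 0.+2%:R by lra.
have [-> _|_ /digitE[j jN ->]] := eqVneq a 0%N.
  rewrite /optimal_digit eqxx => le1.
  have [-> //|_ /digitE[l lN ->]] := eqVneq b 0%N.
  apply: le_trans (cascade_term_nondecreasing lam p 0 l (lower le1)).
  by rewrite addn0 cascade_term_first /cascade_term eqxx subr_ge0.
rewrite /optimal_digit /= (_ : ((p + j).+1 - p.+1)%N = j) //; last by lia.
case/and3P=> ge1 left right.
have le_first l : (l <= j)%N ->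
    cascade_term lam p.+1 (p + j).+1 <= cascade_term lam p.+1 (p + l).+1.
  move=> lj; case/orP: left => [/eqP j0|le_x].
    by rewrite (_ : l = j) //; lia.
  by have := cascade_term_nonincreasing lam p l (j - l); rewrite subnKC //; apply.
have [->|_ /digitE[l lN ->]] := eqVneq b 0%N.
  move=> _; apply: le_trans (le_first 0%N isT) _.
  by rewrite addn0 cascade_term_first /cascade_term eqxx subr_le0.
have [/le_first //|lt_jl] := leqP l j.
have := cascade_term_nondecreasing lam p j (l - j).
by rewrite (subnKC (ltnW lt_jl)); apply; case/orP: right => //; lia.
Qed.

Lemma min_optimal_digit {R : realFieldType} (lam : R) (N i a : nat) :
  0 < lam -> (0 < i)%N -> cascade_digit N i a ->
  (forall b, cascade_digit N i b -> cascade_term lam i a <= cascade_term lam i b) ->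
  optimal_digit lam N i a.
Proof.
case: i => // p lam0 _; rewrite /cascade_digit /optimal_digit => a_in min_a.
have [a0|a0] := eqVneq a 0%N.
  have := min_a p.+1; rewrite a0 cascade_term_first /cascade_term eqxx.
  by rewrite subr_ge0; apply; lia.
pose j := (a - p.+1)%N.
have aE : a = (p + j).+1 by rewrite /j; lia.
have right : (j < N)%N -> lam * p%:R <= j.+2%:R.
  move=> jN; have := min_a (p + j).+2; rewrite aE -subr_ge0.
  have [c c0 ->] := cascade_term_step lam p j.
  by rewrite pmulr_rge0 // subr_ge0; apply; lia.
have left l : j = l.+1 -> l.+2%:R <= lam * p%:R.
  move=> jl; have := min_a (p + l).+1; rewrite aE jl addnS -subr_le0.
  have [c c0 ->] := cascade_term_step lam p l.
  by rewrite pmulr_rle0 // subr_le0; apply; lia.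
apply/and3P; split; rewrite -/j /=.
(* Comparison with [0] settles the case [a = i]; for larger [a] the left neighbour already gives
   [2 <= lam * p%:R], which is stronger. *)
- have := min_a 0%N isT; rewrite aE; case: j left {right aE} => [|l] left.
    by rewrite addn0 cascade_term_first /cascade_term eqxx subr_le0.
  have := left _ erefl; rewrite -!natr1; have : 0 <= l%:R :> R by [].
  by lra.
- by case: j left aE {right} => [|l] left aE;
    [rewrite aE addn0 eqxx | rewrite left ?orbT].
- by have [/right ->|Nj] := ltnP j N; [rewrite orbT | apply/orP; left; lia].
Qed.

(** * From optimal digits to the listed values *)

Lemma floor_natP {R : realType} (a : nat) (y : R) :
  a%:Z = Num.floor y <-> a%:R <= y < a.+1%:R.
Proof.
suff -> : (a%:R <= y < a.+1%:R) = (a%:Z == Num.floor y) by split=> /eqP.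
by rewrite eq_sym floor_eq intrD -!pmulrn natr1.
Qed.

Lemma ceil_natP {R : realType} (a : nat) (y : R) :
  a%:Z = Num.ceil y <-> a%:R < y + 1 <= a.+1%:R.
Proof.
suff -> : (a%:R < y + 1 <= a.+1%:R) = (a%:Z == Num.ceil y) by split=> /eqP.
by rewrite eq_sym ceil_eq intrB -!pmulrn ltrBlDr -natr1 lerD2r.
Qed.

(** Put [x = lam * p%:R] with [p = i - 1]. Away from the ends of the range, digit [i + j] is optimal
    iff [x] lies in the closed interval from [j + 1] to [j + 2]. The floor of [x + p] equals [i + j]
    on this interval without its right end, the ceiling of [x + p - 1] without its left end, so
    together they cover it. *)
Lemma optimal_digit_cases {R : realType} (lam : R) (N i a : nat) :
  0 < lam -> (0 < i)%N ->
  cascade_digit N i a && optimal_digit lam N i a <->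
  [/\ i%:R > 1 + N.+1%:R / lam -> a = (N + i)%N,
      1 + N.+1%:R / lam >= i%:R /\ i%:R >= 1 + 2 / lam ->
        a%:Z = Num.ceil ((i%:R - 1) * (lam + 1) - 1) \/
        a%:Z = Num.floor ((i%:R - 1) * (lam + 1)),
      1 + 2 / lam > i%:R /\ i%:R > 1 / lam -> a = i,
      1 / lam = i%:R -> a = 0%N \/ a = i
    & 1 / lam > i%:R -> a = 0%N].
Proof.
case: i => // p lam0 _.
have iE : p.+1%:R = p%:R + 1 :> R by rewrite natr1.
have divlt c : (1 + c / lam < p.+1%:R) = (c < lam * p%:R).
  by rewrite iE addrC ltrD2r ltr_pdivrMr // mulrC.
have divge c : (p.+1%:R <= 1 + c / lam) = (lam * p%:R <= c) by rewrite !leNgt divlt.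
have divle c : (1 + c / lam <= p.+1%:R) = (c <= lam * p%:R).
  by rewrite iE addrC lerD2r ler_pdivrMr // mulrC.
have divgt c : (p.+1%:R < 1 + c / lam) = (lam * p%:R < c) by rewrite !ltNge divle.
have invlt : (1 / lam < p.+1%:R) = (1 < lam * p.+1%:R).
  by rewrite ltr_pdivrMr // mulrC.
have invgt : (p.+1%:R < 1 / lam) = (lam * p.+1%:R < 1).
  by rewrite ltr_pdivlMr // mulrC.
have inveq : 1 / lam = p.+1%:R <-> lam * p.+1%:R = 1.
  split=> [<-|yE]; first by rewrite mul1r divff ?gt_eqF.
  by rewrite -[X in X / _]yE mulrC mulKf ?gt_eqF.
have y_eq : (p.+1%:R - 1) * (lam + 1) = lam * p%:R + p%:R by rewrite iE; ring.
have p0 : 0 <= p%:R :> R by [].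
have lamE : lam * p.+1%:R = lam * p%:R + lam by rewrite iE mulrDr mulr1.
have opt0 : cascade_digit N p.+1 0 && optimal_digit lam N p.+1 0
    = (lam * p.+1%:R <= 1) by [].
have optE j : cascade_digit N p.+1 (p + j).+1 && optimal_digit lam N p.+1 (p + j).+1
    = [&& (j <= N)%N, 1 <= lam * p.+1%:R, (j == 0)%N || (j.+1%:R <= lam * p%:R)
        & (j == N) || (lam * p%:R <= j.+2%:R)].
  rewrite /optimal_digit /= (_ : ((p + j).+1 - p.+1)%N = j); last by lia.
  by congr [&& _, _, _ || _ & _ || _]; rewrite /cascade_digit; lia.
have digitP : cascade_digit N p.+1 a -> a = 0%N \/ exists j, a = (p + j).+1.
  by case/orP=> [/eqP|a_in]; [left | right; exists (a - p.+1)%N; lia].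
rewrite divlt divge divle divgt invlt invgt y_eq.
move: (lam * p%:R) (lam * p.+1%:R) lamE (mulr_ge0 (ltW lam0) p0) inveq opt0 optE
  {divlt divge divle divgt invlt invgt y_eq} => x y yE x0 inveq opt0 optE.
have N0 : 0 <= N%:R :> R by [].
split.
  move=> opt_a; have [/digitP dig _] := andP opt_a.
  case: dig opt_a => [->|[j ->]]; rewrite ?opt0 ?optE => opt_a.
    split=> //; last by left.
    - by rewrite -natr1 => lt_x; exfalso; lra.
    - by move=> [_ x2]; exfalso; lra.
    - by move=> [_ y1]; exfalso; lra.
  have [jN y1 /orP xl /orP xr] := and4P opt_a.
  have jR : 0 <= j%:R :> R by [].
  have j_le : (j%:R <= N%:R :> R) by rewrite ler_nat.
  (* A positive offset would need [j + 1 <= x], that is, [2 <= x]. *)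
  have x_lt : x < 2 -> j = 0%N.
    move=> x2; case: xl => [/eqP //|]; rewrite -natr1 => le_x.
    have : j%:R < 1%:R :> R by lra.
    by rewrite ltr_nat ltnS leqn0 => /eqP.
  split.
  - move=> lt_x; suff -> : j = N by rewrite addnS addnC.
    case: xr => [/eqP //|/(lt_le_trans lt_x)]; rewrite ltr_nat !ltnS => Nj.
    by apply/eqP; rewrite eqn_leq jN.
  - move=> [xN x2].
    have {}xl : j.+1%:R <= x.
      by case: xl => [/eqP ->|//]; lra.
    have {}xr : x <= j.+2%:R.
      by case: xr => [/eqP ->|//]; move: xN; rewrite -!natr1; lra.
    move: xl xr; rewrite -!natr1 => xl xr.
    have [eq_x|ne_x] := eqVneq x (j%:R + 1); [right | left].
      by apply/floor_natP/andP; rewrite -!natr1 natrD; split; lra.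
    have : j%:R + 1 < x by rewrite lt_neqAle eq_sym ne_x.
    by move=> lt_x; apply/ceil_natP/andP; rewrite -!natr1 natrD; split; lra.
  - by move=> [/x_lt -> _]; rewrite addn0.
  - by move=> /inveq y1'; right; rewrite x_lt ?addn0 //; lra.
  - by move=> y_lt; exfalso; lra.
case=> c1 c2 c3 c4 c5.
have [lt_x|le_x] := ltP N.+1%:R x.
  rewrite c1 // addnS addnC optE leqnn (ltW lt_x) eqxx orbT andbT /=.
  by move: lt_x; rewrite -natr1; lra.
have [x2|x2] := leP 2 x.
  have bd : exists2 j, a = (p + j).+1 & j.+1%:R <= x <= j.+2%:R.
    (* Since [2 <= x], both rounded values exceed [p], so [a] has the form [i + j]. *)
    have a_gt : (p < a)%N.
      rewrite -(ltr_nat R);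
      case: (c2 (conj le_x x2)) => [/ceil_natP|/floor_natP] /andP[H1 H2].
        by move: H2; rewrite -natr1; lra.
      by move: H2; rewrite -natr1; lra.
    have aE : a = (p + (a - p.+1)).+1 by rewrite -addSn subnKC.
    exists (a - p.+1)%N => //; move: (congr1 (fun c => c%:R : R) aE).
    rewrite -!natr1 natrD; move: (a - p.+1)%N => j {}aE.
    by case: (c2 (conj le_x x2)) => [/ceil_natP|/floor_natP] /andP[];
      rewrite -?natr1 => H1 H2;
      apply/andP; split; lra.
  have [j -> /andP[x_ge x_le]] := bd.
  rewrite optE x_ge x_le !orbT !andbT; apply/andP; split; last by lra.
  by have := le_trans x_ge le_x; rewrite ler_nat.
have [y_lt|y_gt|y_eq] := ltgtP y 1.
- by rewrite c5 // opt0 ltW.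
- by have := optE 0%N; rewrite addn0 c3 // => ->; rewrite (ltW y_gt) /= (ltW x2) orbT.
- case: (c4 (inveq.2 y_eq)) => ->; first by rewrite opt0 y_eq.
  by have := optE 0%N; rewrite addn0 => ->; rewrite y_eq lexx /= (ltW x2) orbT.
Qed.

(** * Optimal and largest cascades *)

Lemma optimal_cascade {R : realFieldType} (lam : R) (N k : nat) : 0 < lam ->
  exists2 b, cascade_shape k b & forall i, (0 < i)%N ->
    cascade_digit N i (b i) && optimal_digit lam N i (b i).
Proof.
(* [d p] is the least offset whose next increment is nonnegative, capped at [N]. It is nondecreasing
   because [lam * p%:R] grows with [p], so the digits [i + d i.-1] increase strictly; likewise the
   zeros form an initial run of positions. *)
move=> lam0; pose P p j := (j == N) || (lam * p%:R <= j.+2%:R).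
have exP p : exists j, P p j by exists N; rewrite /P eqxx.
pose d p := ex_minn (exP p).
have dP p : P p (d p) by rewrite /d; case: ex_minnP.
have d_min p j : P p j -> (d p <= j)%N by rewrite /d; case: ex_minnP => ? _; apply.
have d_mono p : (d p <= d p.+1)%N.
  apply: d_min; case/orP: (dP p.+1) => [/eqP ->|le_x]; first by rewrite /P eqxx.
  by apply/orP; right; apply: le_trans le_x; rewrite ler_pM2l // ler_nat.
exists (fun i => if lam * i%:R <= 1 then 0%N else (i + d i.-1)%N).
  split=> i /andP[i1 _]; case: ifP => [|lt1]; try by left.
    by right; rewrite leq_addr.
  right; case: ifP => [le1|_].
    suff : lam * i%:R <= 1 by rewrite lt1.
    by apply: le_trans le1; rewrite ler_pM2l // ler_nat.
  by case: i i1 {lt1} => // p _ /=; have := d_mono p; lia.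
case=> // p _; case: ifP => [le1|/negbT]; first by rewrite /optimal_digit.
rewrite -ltNge => /ltW ge1.
have dN : (d p <= N)%N by apply: d_min; rewrite /P eqxx.
rewrite /optimal_digit /cascade_digit /= addKn ge1 leq_addr leq_add2l dN /=.
have := dP p; rewrite eqn_add2l /P => ->; rewrite andbT.
case Ed : (d p) => [|e]; first by rewrite addn0 eqxx.
(* Minimality of [d p = e.+1] rules out [e], which is precisely the condition on the left
   neighbour. *)
apply/orP; right; have : ~~ P p e by apply/negP=> /d_min; rewrite Ed ltnn.
by rewrite negb_or -ltNge => /andP[_ /ltW].
Qed.

(** Hockey-stick identity. For [n = (N + k).+1] the largest admissible digits represent
    ['C(n, k) - 1], one set short of the full layer. *)
Lemma max_cascade_sum (N k : nat) :
  (cascade_sum k (addn N)).+1 = 'C((N + k).+1, k).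
Proof.
elim: k => [|k IH]; first by rewrite /cascade_sum big_geq.
rewrite /cascade_sum big_nat_recr //= -addSn -/(cascade_sum k _) IH.
by rewrite !addnS binS addnC.
Qed.

(** The same identity one level down: the shadow of that family already has the size of the whole
    lower layer. *)
Lemma max_cascade_shadow (N k : nat) :
  cascade_shadow k.+1 (addn N) = 'C((N + k.+1).+1, k).
Proof.
elim: k => [|k IH]; first by rewrite /cascade_shadow big_nat1 addnS /= !bin0.
rewrite /cascade_shadow big_nat_recr //= -/(cascade_shadow k.+1 _) IH.
by rewrite !addnS mul1n binS addnC.
Qed.

Lemma cascade_shape_digit {n k : nat} {a : nat -> nat} :
  cascade_shape k a -> (a k < n)%N ->
  forall i, (1 <= i <= k)%N -> cascade_digit (n - k - 1) i (a i).
Proof.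
case=> ge_i inc lt_n i /andP[i1 ik]; rewrite /cascade_digit.
have [//|ai0] := eqVneq (a i) 0%N.
have gap d : (i + d <= k)%N -> (a i + d <= a (i + d))%N.
  elim: d => [|d IH] le_k; first by rewrite !addn0.
  by have := inc (i + d)%N; have := IH; rewrite !addnS; lia.
have := gap (k - i)%N; rewrite subnKC //; have := ge_i i; lia.
Qed.

(** * Weights of full squashed flat antichains *)

Lemma card_layer (n i : nat) : #|layer n i| = 'C(n, i).
Proof. by rewrite /layer card_draws card_ord. Qed.

Lemma layer_initial (n k : nat) : squashed_initial k (layer n k).
Proof. by split=> // F G _ cG _; rewrite inE cG. Qed.

Lemma card_first_squashed {n k m : nat} :
  (m <= 'C(n, k))%N -> (0 < k)%N -> #|first_squashed n k m| = m.
Proof.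
rewrite leq_eqVlt => /orP[/eqP -> _|lt_m k0].
  by rewrite -card_layer first_squashed_initial //; apply: layer_initial.
have [a [sh lt_n <-]] := cascade_exists _ _ _ lt_m k0.
have [D [iniD <- _ _]] := cascade_initial sh (fun=> lt_n).
by rewrite first_squashed_initial.
Qed.

Definition squashed_family (n k m : nat) : {set {set 'I_n}} :=
  first_squashed n k m :|: (layer n k.-1 :\: shadow k (first_squashed n k m)).

Lemma squashed_family_upper (n k m : nat) : (0 < k)%N ->
  squashed_family n k m :&: layer n k = first_squashed n k m.
Proof.
move=> k0; apply/setP=> G; rewrite !inE.
by case: (#|G| =P k) => [->|_]; rewrite ?andbF ?andbT //= (_ : k == k.-1 = false)
   ?andbF ?orbF //; lia.
Qed.

Lemma squashed_family_lower (n k m : nat) : (0 < k)%N ->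
  squashed_family n k m :&: layer n k.-1
    = layer n k.-1 :\: shadow k (first_squashed n k m).
Proof.
move=> k0; apply/setP=> G; rewrite !inE.
by case: (#|G| =P k.-1) => [->|_];
  rewrite ?andbF ?andbT //= (_ : k.-1 == k = false) //; lia.
Qed.

Lemma weight_squashed_family {R : realType} {n k m : nat} (alpha beta : R) :
  (m <= 'C(n, k))%N -> (0 < k)%N ->
  weight k alpha beta (squashed_family n k m)
    = alpha * m%:R
      + beta * ('C(n, k.-1)%:R - #|shadow k (first_squashed n k m)|%:R).
Proof.
move=> le_m k0; rewrite /weight squashed_family_upper // squashed_family_lower //.
have sub : shadow k (first_squashed n k m) \subset layer n k.-1.
  by apply/subsetP=> H; rewrite inE => /andP[].
rewrite card_first_squashed // cardsD (setIidPr sub) natrB ?subset_leq_card //.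
by rewrite card_layer.
Qed.

Lemma cascade_sum_le {n k : nat} {a : nat -> nat} :
  cascade_shape k a -> (a k < n)%N -> (cascade_sum k a <= 'C(n, k))%N.
Proof.
move=> sh lt_n; have [D [[sub _] <- _ _]] := cascade_initial sh (fun=> lt_n).
by rewrite -card_layer subset_leq_card.
Qed.

Lemma card_shadow_cascade {n k : nat} {a : nat -> nat} :
  cascade_shape k a -> (a k < n)%N ->
  #|shadow k (first_squashed n k (cascade_sum k a))| = cascade_shadow k a.
Proof.
move=> sh lt_n; have [D [iniD <- <- _]] := cascade_initial sh (fun=> lt_n).
by rewrite first_squashed_initial.
Qed.

Lemma weight_cascade {R : realType} {n k : nat} {a : nat -> nat} (alpha beta : R) :
  alpha != 0 -> (0 < k)%N -> cascade_shape k a -> (a k < n)%N ->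
  weight k alpha beta (squashed_family n k (cascade_sum k a))
    = beta * 'C(n, k.-1)%:R
      + alpha * \sum_(1 <= i < k.+1) cascade_term (beta / alpha) i (a i).
Proof.
move=> alpha0 k0 sh lt_n.
rewrite weight_squashed_family ?cascade_sum_le // card_shadow_cascade //.
have -> : \sum_(1 <= i < k.+1) cascade_term (beta / alpha) i (a i)
    = (cascade_sum k a)%:R - beta / alpha * (cascade_shadow k a)%:R :> R.
  rewrite /cascade_sum /cascade_shadow !natr_sum mulr_sumr -sumrB.
  apply: eq_big_nat => i /andP[i1 _]; rewrite /cascade_term natrM.
  case: eqP => [->|_]; last by rewrite mul1r.
  by rewrite bin0n mul0r mulr0 subr0; case: i i1.
by field.
Qed.

(** The smaller family leaves nothing in the lower layer, so the last [k]-set only adds [alpha]. *)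
Lemma weight_full_gt {R : realType} {n k : nat} (alpha beta : R) :
  0 < alpha -> 0 < beta -> (0 < k < n)%N ->
  weight k alpha beta (squashed_family n k (cascade_sum k (addn (n - k - 1))))
    < weight k alpha beta (squashed_family n k 'C(n, k)).
Proof.
move=> alpha0 beta0 /andP[k0 lt_kn].
have sh : cascade_shape k (addn (n - k - 1)) by split=> i; lia.
have lt_n : (n - k - 1 + k < n)%N by lia.
rewrite !weight_squashed_family ?(cascade_sum_le sh) // (card_shadow_cascade sh) //.
have -> : cascade_shadow k (addn (n - k - 1)) = 'C(n, k.-1).
  case: k k0 lt_kn {sh lt_n} => // k _ lt_kn.
  by rewrite max_cascade_shadow; congr 'C(_, _); lia.
have -> : 'C(n, k) = (cascade_sum k (addn (n - k - 1))).+1.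
  by rewrite max_cascade_sum; congr 'C(_, _); lia.
rewrite subrr mulr0 addr0; apply: ltr_wpDr; last by rewrite ltr_pM2l // ltr_nat.
rewrite mulr_ge0 ?(ltW beta0) // subr_ge0 ler_nat -card_layer subset_leq_card //.
by apply/subsetP=> H; rewrite inE => /andP[].
Qed.

(** * The characterisation of minimum weight *)

Theorem theorem7 (R : realType) (n k : nat) (hk : (1 < k < n)%N)
    (alpha beta : R) (halpha : 0 < alpha) (hbeta : 0 < beta)
    (F A B : {set {set 'I_n}})
    (hF : F = A :|: B) (hA : A \subset layer n k) (hB : B \subset layer n k.-1)
    (hfsfa : fsfa k F)
    (a : nat -> nat) (ha : is_cascade k #|A| a) :
  let lambda := beta / alpha in
  min_weight_fsfa k alpha beta F <->
  (forall i : nat, (1 <= i <= k)%N ->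
     [/\ i%:R > 1 + (n - k)%:R / lambda -> a i = (n - k - 1 + i)%N,
         1 + (n - k)%:R / lambda >= i%:R /\ i%:R >= 1 + 2 / lambda ->
           (a i)%:Z = Num.ceil ((i%:R - 1) * (lambda + 1) - 1) \/
           (a i)%:Z = Num.floor ((i%:R - 1) * (lambda + 1)),
         1 + 2 / lambda > i%:R /\ i%:R > 1 / lambda -> a i = i,
         1 / lambda = i%:R -> a i = 0%N \/ a i = i
       & 1 / lambda > i%:R -> a i = 0%N]).
Proof.
move=> lambda.
have k0 : (0 < k)%N by lia.
have lt_kn : (0 < k < n)%N by lia.
have lam0 : 0 < lambda by rewrite divr_gt0.
have alphaN0 : alpha != 0 by rewrite gt_eqF.
have [m le_m Em] := hfsfa; rewrite -/(squashed_family n k m) in Em.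
have EA : A = first_squashed n k m.
  rewrite -squashed_family_upper // -Em hF setIUl (setIidPl hA).
  rewrite (_ : B :&: _ = set0) ?setU0 //; apply/setP=> G; rewrite !inE.
  apply/negbTE/negP=> /andP[/(subsetP hB)]; rewrite inE => /eqP -> /eqP; lia.
have [sum_a _] := ha; rewrite EA card_first_squashed // -/(cascade_sum k a) in sum_a.
have sh := is_cascade_shape ha.
have fsfa_family m' : (m' <= 'C(n, k))%N -> fsfa k (squashed_family n k m').
  by exists m'.
have fsfa_cascade a' : cascade_shape k a' -> (a' k < n)%N ->
    fsfa k (squashed_family n k (cascade_sum k a')).
  by move=> sh' lt'; apply: fsfa_family; apply: cascade_sum_le.
pose N := (n - k - 1)%N.
have nkE : (n - k)%N = N.+1 by rewrite /N; lia.
have sh_max : cascade_shape k (addn N) by split=> i; lia.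
have lt_max : (N + k < n)%N by rewrite /N; lia.
have casesP i : (1 <= i <= k)%N -> _ :=
  fun Hi => optimal_digit_cases lambda N i (a i) lam0 (proj1 (andP Hi)).
rewrite nkE subn1 succnK.
(* A top digit of at least [n] means the full layer. Both sides exclude it: the listed values are at
   most [k + N < n], and the largest cascade below [n] has smaller weight. *)
have [lt_a|ge_a] := ltnP (a k) n; last first.
  split=> [[_ min_F]|cond]; last first.
    have Hk : (1 <= k <= k)%N by lia.
    have /andP[dig _] := (casesP k Hk).2 (cond k Hk).
    by move: dig; rewrite /cascade_digit; lia.
  have Em' : m = 'C(n, k).
    apply/eqP; rewrite eqn_leq le_m sum_a /cascade_sum big_nat_recr //=.
    exact: leq_trans (leq_bin2l k ge_a) (leq_addl _ _).
  have := min_F _ (fsfa_cascade _ sh_max lt_max).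
  by rewrite Em Em' leNgt weight_full_gt.
have digit_a := cascade_shape_digit sh lt_a; rewrite -/N in digit_a.
have weight_F := weight_cascade alpha beta alphaN0 k0 sh lt_a.
rewrite -sum_a -Em in weight_F.
split=> [[_ min_F] i Hi|cond].
  apply/(casesP i Hi); rewrite digit_a //=.
  (* Against a digitwise optimal cascade [b], the term differences are all nonnegative and their sum
     is nonpositive, so each vanishes and every digit of [a] is a minimiser. *)
  have [b sh_b opt_b] := optimal_cascade lambda N k lam0.
  have lt_b : (b k < n)%N.
    by have /andP[+ _] := opt_b k k0; rewrite /cascade_digit /N; lia.
  have := min_F _ (fsfa_cascade _ sh_b lt_b).
  rewrite weight_F weight_cascade // lerD2l ler_pM2l // -subr_le0 -sumrB => le0.
  have le_term j : (1 <= j < k.+1)%N ->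
      0 <= cascade_term lambda j (a j) - cascade_term lambda j (b j).
    move=> Hj; have j0 : (0 < j)%N by lia.
    have /andP[dig_b min_b] := opt_b j j0.
    rewrite subr_ge0; apply: optimal_digit_min min_b _ => //; apply: digit_a; lia.
  have sum0 : \sum_(1 <= j < k.+1)
      (cascade_term lambda j (a j) - cascade_term lambda j (b j)) == 0.
    by rewrite eq_le le0 big_nat sumr_ge0.
  have i0 : (0 < i)%N by lia.
  have eq_i : cascade_term lambda i (a i) = cascade_term lambda i (b i).
    apply/eqP; rewrite -subr_eq0; move: sum0; rewrite big_nat psumr_eq0 //.
    move/allP/(_ i); rewrite mem_index_iota => all_i.
    by have := all_i _; rewrite ltnS Hi /=; apply.
  apply: min_optimal_digit => // [|c dig_c]; first exact: digit_a.
  have /andP[dig_b min_b] := opt_b i i0.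
  by rewrite eq_i; apply: optimal_digit_min min_b dig_c.
have le_cascade a' : cascade_shape k a' -> (a' k < n)%N ->
    weight k alpha beta F
      <= weight k alpha beta (squashed_family n k (cascade_sum k a')).
  move=> sh' lt'; rewrite weight_F weight_cascade // lerD2l ler_pM2l //.
  rewrite big_nat [leRHS]big_nat; apply: ler_sum => i Hi.
  have Hi' : (1 <= i <= k)%N by lia.
  have /andP[dig_a opt_a] := (casesP i Hi').2 (cond i Hi').
  apply: optimal_digit_min opt_a _ => //; first by lia.
  exact: cascade_shape_digit.
split=> // F' [m' le_m' ->]; rewrite -/(squashed_family n k m').
(* A competitor is either the full layer, beaten through the largest cascade, or given by a cascade
   with top digit below [n]. *)
move: le_m'; rewrite leq_eqVlt => /orP[/eqP ->|lt_m'].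
  exact: le_trans (le_cascade _ sh_max lt_max) (ltW (weight_full_gt _ _ _ _ _)).
have [a' [sh' lt' <-]] := cascade_exists _ _ _ lt_m' k0.
exact: le_cascade.
Qed.
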